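(* Let $A$ be a finite-dimensional Leibniz algebra over a field $F$. Then $A$ is triangulable (on itself) if and only if $A^2$ is nil on $A$.
   Context: A Leibniz algebra over a field $F$ is an $F$-vector space $A$ with a bilinear product satisfying the (left) Leibniz identity $x(yz) = (xy)z + y(xz)$ for all $x,y,z \in A$. For $x \in A$, $T_x: A \to A$ denotes left multiplication $a \mapsto xa$ and $S_x : A \to A$ denotes right multiplication $a \mapsto ax$. $A^2$ denotes the span of all products $xy$ with $x,y\in A$. A subalgebra $C$ of $A$ is said to be nil on $A$ if $T_x$ is a nilpotent linear transformation of $A$ for every $x \in C$ (it is known that then $S_x$ is nilpotent as well for every $x\in C$, and that $C$ acts nilpotently on $A$, i.e. there is $n$ such that every product of $n$ operators from $\{T_x, S_x : x \in C\}$ is zero on $A$). Let $K$ be the algebraic closure of $F$. The algebra $A$ is called triangulable (on itself) if $K \otimes_F A$, a Leibniz algebra over $K$, has a $K$-basis with respect to which the matrices of all left multiplications and all right multiplications by elements of $K \otimes_F A$ are upper triangular. *)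

(* Defs.v *)
From HB Require Import structures.
From mathcomp Require Import all_boot all_order all_algebra.

Set Implicit Arguments.
Unset Strict Implicit.
Unset Printing Implicit Defensive.

Import GRing.Theory.
Local Open Scope ring_scope.

Definition left_leibniz (V : zmodType) (mul : V -> V -> V) : Prop :=
  forall x y z : V, mul x (mul y z) = mul (mul x y) z + mul y (mul x z).

Definition nilpotent_map (V : zmodType) (f : V -> V) : Prop :=
  exists n : nat, forall v : V, iter n f v = 0.

Section Algebra.

Variables (F : fieldType) (A : vectType F).
Implicit Types (mul : A -> A -> A) (C : {vspace A}).

(* left multiplication by [x] is [mul x], right multiplication is [mul^~ x] *)
Definition nil_on mul C : Prop :=
  forall x : A, x \in C -> nilpotent_map (mul x).

(* The products of basis vectors already span all products (see [mem_square]
   below), as for the product of subspaces in [falgebra]. *)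
Definition square mul : {vspace A} :=
  <<[seq mul x y | x <- vbasis {:A}, y <- vbasis {:A}]>>%VS.

(* Column convention: column [j] holds the coordinates of the image of the
   [j]-th basis vector. *)
Definition mx_in_basis n (b : n.-tuple A) (f : A -> A) : 'M[F]_n :=
  \matrix_(i, j) coord b i (f b`_j).

End Algebra.

Definition upper_triangular (R : nzRingType) n (M : 'M[R]_n) : Prop :=
  forall i j : 'I_n, (j < i)%N -> M i j = 0.

Definition has_triangular_basis (F : fieldType) (A : vectType F)
    (mul : A -> A -> A) : Prop :=
  exists b : (\dim {:A}).-tuple A, basis_of {:A} b /\
    forall x : A, upper_triangular (mx_in_basis b (mul x)) /\
                  upper_triangular (mx_in_basis b (mul^~ x)).

(* [K], with the embedding [iota], is an algebraic closure of [F]: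
   algebraic closedness is carried by the type of [K]. *)
Definition algebraic_closure (F : fieldType) (K : closedFieldType)
    (iota : {rmorphism F -> K}) : Prop :=
  forall z : K, algebraicOver iota z.

(* MathComp has no tensor products.  With the basis [e = vbasis {:A}] of [A],
   [K (x)_F A] is encoded as K^(dim A), the row [u] standing for
   [\sum_i u 0 i (x) e_i].  By the universal property [tensor_universal] below
   this is the tensor product, independently of [e]. *)
Section ScalarExtension.

Variables (F K : fieldType) (iota : {rmorphism F -> K}) (A : vectType F).

Local Notation tensor := 'rV[K]_(\dim {:A}).

(* a |-> 1 (x) a *)
Definition tensor1 (a : A) : tensor :=
  \row_i iota (coord (vbasis {:A}) i a).

Definition tensor_mul (mul : A -> A -> A) (u v : tensor) : tensor :=
  \sum_i \sum_j
    (u 0 i * v 0 j) *: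
      tensor1 (mul (vbasis {:A})`_i (vbasis {:A})`_j).

End ScalarExtension.

Definition triangulable (F : fieldType) (K : closedFieldType)
    (iota : {rmorphism F -> K}) (A : vectType F) (mul : A -> A -> A) : Prop :=
  has_triangular_basis (tensor_mul iota mul).

Section SquareTheory.

Variables (F : fieldType) (A : vectType F) (mul : {bilinear A -> A -> A}).

Lemma bilinear_vbasisE (x y : A) :
  mul x y = \sum_i \sum_j
    (coord (vbasis {:A}) i x * coord (vbasis {:A}) j y) *:
      mul (vbasis {:A})`_i (vbasis {:A})`_j.
Proof.
rewrite {1}(coord_vbasis (memvf x)) {1}(coord_vbasis (memvf y)).
rewrite linear_sumlz; apply: eq_bigr => i _.
rewrite linear_sumr; apply: eq_bigr => j _.
by rewrite linearZl_LR linearZr_LR /= scalerA.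
Qed.

Lemma mul_square (x y : A) : mul x y \in square mul.
Proof.
rewrite bilinear_vbasisE; apply: memv_suml => i _; apply: memv_suml => j _.
apply/memvZ/memv_span; apply: allpairs_f; apply: mem_nth;
  by rewrite size_tuple.
Qed.

Lemma mem_square (v : A) :
  v \in square mul <->
  exists (n : nat) (c : 'I_n -> F) (x y : 'I_n -> A),
    v = \sum_i c i *: mul (x i) (y i).
Proof.
split=> [|[n [c [x [y ->]]]]]; last first.
  by apply: memv_suml => i _; apply/memvZ/mul_square.
pose s := [seq (x, y) | x <- vbasis {:A}, y <- vbasis {:A}].
pose t := in_tuple [seq mul p.1 p.2 | p <- s].
rewrite /square; have -> : [seq mul x y | x <- vbasis {:A}, y <- vbasis {:A}] = t.
  by rewrite /t /= /s map_allpairs.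
move=> /coord_span ->; exists (size t), (fun i => coord t i v).
exists (fun i => (nth (0, 0) s i).1), (fun i => (nth (0, 0) s i).2).
apply: eq_bigr => i _; congr (_ *: _); rewrite (nth_map (0, 0)) //.
by rewrite -(size_map (fun p => mul p.1 p.2)).
Qed.

End SquareTheory.

Section ScalarExtensionTheory.

Variables (F K : fieldType) (iota : {rmorphism F -> K}) (A : vectType F).

Local Notation tensor := 'rV[K]_(\dim {:A}).
Local Notation e := (vbasis {:A}).
Local Notation "1(x)" := (@tensor1 F K iota A).

Let coord_e (i j : 'I_(\dim {:A})) : coord e i e`_j = (i == j)%:R.
Proof. by rewrite coord_free ?[j == i]eq_sym // (basis_free (vbasisP _)). Qed.

Lemma tensor1D (x y : A) : 1(x) (x + y) = 1(x) x + 1(x) y.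
Proof. by apply/rowP=> i; rewrite !mxE linearD rmorphD. Qed.

Lemma tensor1Z (a : F) (x : A) : 1(x) (a *: x) = iota a *: 1(x) x.
Proof. by apply/rowP=> i; rewrite !mxE linearZ rmorphM. Qed.

Lemma tensor1_sum (I : finType) (f : I -> A) :
  1(x) (\sum_i f i) = \sum_i 1(x) (f i).
Proof.
apply: (big_morph _ tensor1D).
by apply/rowP=> i; rewrite !mxE linear0 rmorph0.
Qed.

Lemma tensor_basisE (u : tensor) :
  u = \sum_i u 0 i *: 1(x) e`_i.
Proof.
rewrite [LHS](row_sum_delta u); apply: eq_bigr => i _; congr (_ *: _).
by apply/rowP=> j; rewrite !mxE coord_e rmorph_nat eqxx.
Qed.

Lemma tensor_ext (V : lmodType K) (f g : tensor -> V) :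
  linear f -> linear g -> (forall x, f (1(x) x) = g (1(x) x)) -> f =1 g.
Proof.
move=> f_lin g_lin fg u; pose h v := f v - g v.
have h_lin : linear h.
  by move=> a x y; rewrite /h f_lin g_lin opprD addrACA -scalerBr.
pose L := GRing.isLinear.Build K tensor V _ h h_lin.
pose hL : {linear tensor -> V} := HB.pack h L.
apply/eqP; rewrite -subr_eq0 -[_ - _]/(hL u) (tensor_basisE u) linear_sum.
by apply/eqP/big1 => i _; rewrite linearZ /= /h fg subrr scaler0.
Qed.

Lemma tensor_universal (V : lmodType K) (f : A -> V)
    (fD : forall x y, f (x + y) = f x + f y)
    (fZ : forall a x, f (a *: x) = iota a *: f x) :
  exists g : {linear tensor -> V},
    (forall x, g (1(x) x) = f x) /\
    forall h : {linear tensor -> V},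
      (forall x, h (1(x) x) = f x) -> h =1 g.
Proof.
pose g (u : tensor) := \sum_i u 0 i *: f e`_i.
have g_lin : linear g.
  move=> a u v; rewrite /g scaler_sumr -big_split; apply: eq_bigr => i _.
  by rewrite !mxE scalerDl scalerA.
pose L := GRing.isLinear.Build K (tensor) V _ g g_lin.
pose gL : {linear tensor -> V} := HB.pack g L.
exists gL; split=> [x | h hf u]; last first.
  rewrite [in LHS](tensor_basisE u) linear_sum; apply: eq_bigr => i _.
  by rewrite linearZ hf.
have f0 : f 0 = 0 by rewrite -(scale0r (0 : A)) fZ rmorph0 scale0r.
rewrite [in RHS](coord_vbasis (memvf x)) (big_morph f fD f0).
by apply: eq_bigr => i _; rewrite fZ mxE.
Qed.

Variable mul : {bilinear A -> A -> A}.

Local Notation tmul := (@tensor_mul F K iota A mul).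

Lemma tensor_mul_bilinear : bilinear_for *:%R *:%R tmul.
Proof.
split=> w a u v; rewrite /tensor_mul /= scaler_sumr -big_split;
  apply: eq_bigr => i _ /=; rewrite scaler_sumr -big_split; apply: eq_bigr => j _ /=;
  rewrite !mxE scalerA -scalerDl; congr (_ *: _).
- by rewrite mulrDl mulrA.
- by rewrite mulrDr mulrCA.
Qed.

HB.instance Definition _ :=
  bilinear_isBilinear.Build K (tensor) (tensor) (tensor)
    *:%R *:%R tmul tensor_mul_bilinear.

Lemma tensor1M (x y : A) : tmul (1(x) x) (1(x) y) = 1(x) (mul x y).
Proof.
rewrite [in RHS]bilinear_vbasisE tensor1_sum; apply: eq_bigr => i _.
rewrite tensor1_sum; apply: eq_bigr => j _.
by rewrite tensor1Z !mxE rmorphM.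
Qed.

Lemma tensor_leibniz : left_leibniz mul -> left_leibniz tmul.
Proof.
move=> leib u v w; have [tl tr] := tensor_mul_bilinear.
apply: (tensor_ext (f := fun u => tmul u (tmul v w))
  (g := fun u => tmul (tmul u v) w + tmul v (tmul u w))) => [|a x y|x] /=.
- exact: tl.
- by rewrite !tl tr scalerDr addrACA.
apply: (tensor_ext (f := fun v => tmul (1(x) x) (tmul v w))
  (g := fun v => tmul (tmul (1(x) x) v) w + tmul v (tmul (1(x) x) w)))
  => [a y z|a y z|y] /=.
- by rewrite tl tr.
- by rewrite tr !tl scalerDr addrACA.
apply: (tensor_ext (f := fun w => tmul (1(x) x) (tmul (1(x) y) w))
  (g := fun w => tmul (tmul (1(x) x) (1(x) y)) w +
                 tmul (1(x) y) (tmul (1(x) x) w))) => [a z t|a z t|z] /=.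
- by rewrite !tr.
- by rewrite !tr scalerDr addrACA.
by rewrite !tensor1M -tensor1D leib.
Qed.

End ScalarExtensionTheory.

(* Main.v *)
Require Import Defs.
From HB Require Import structures.
From mathcomp Require Import all_boot all_order all_algebra.

Set Implicit Arguments.
Unset Strict Implicit.
Unset Printing Implicit Defensive.

Import GRing.Theory.
Local Open Scope ring_scope.

(** Write [T_x] and [S_x] for left and right multiplication by [x].

    If all [T_x] are triangular in a common basis, then [T_(xy)], which by the
    Leibniz identity is the commutator of [T_x] and [T_y], is strictly
    triangular; hence every element of the square acts nilpotently on the
    scalar extension, and so on [A] ([nil_square_of_triangular_basis]).

    Conversely, let the square [A^2] be nil on [A]. By Engel's theorem
    ([engel]) it acts nilpotently on every section of [A]. This nilpotency
    passes to the scalar extension ([tensor_acts_nilpotently]). This is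
    where Engel's theorem is needed: a [K]-combination of nilpotent
    operators may fail to be nilpotent, so the nil condition does not
    directly extend from [A^2] to [K (x) A^2]. Over [K] the basis is built
    one vector at a time, each new vector being a common eigenvector of all
    multiplications modulo the span [M] of the previous ones ([flag_step]).
    For the left multiplications: on the vectors that [A^2] sends into [M],
    the [T_x] commute modulo [M], and commuting operators over an
    algebraically closed field have a common eigenvector. For the right
    multiplications, the point is that [xy + yx] lies in the left center
    [Z = {z | T_z = 0}]. If [Z] is contained in [M], then [S_x = - T_x]
    modulo [M]; otherwise the eigenvector can be looked for inside [Z],
    where all [S_x] vanish.

    Quotient modules are replaced throughout by pairs of subspaces [M], [U]
    with [U] not contained in [M], a nonzero vector of the quotient being an
    element of [U] outside [M]. *)

(** * Engel's theorem for left multiplications *)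

Section NilpotentAction.

Variables (F : fieldType) (A : vectType F) (mul : {bilinear A -> A -> A}).
Implicit Types (C M U : {vspace A}) (x y z : A) (a : F).

Lemma mulDl x y z : mul (x + y) z = mul x z + mul y z.
Proof. exact: linearDl. Qed.
Lemma mulDr x y z : mul x (y + z) = mul x y + mul x z.
Proof. exact: linearD. Qed.
Lemma mulZl a x y : mul (a *: x) y = a *: mul x y.
Proof. exact: linearZl_LR. Qed.
Lemma mulZr a x y : mul x (a *: y) = a *: mul x y.
Proof. exact: linearZr_LR. Qed.
Lemma mulBr x y z : mul x (y - z) = mul x y - mul x z.
Proof. exact: linearB. Qed.

Lemma ltn_codim_add_line U C x :
    (U <= C)%VS -> ~~ (C <= U)%VS -> x \notin U ->
  (\dim C - \dim (U + <[x]>) < \dim C - \dim U)%N.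
Proof.
move=> UC CU xU; rewrite ltn_sub2l // ltnNge.
  by apply: contra CU; rewrite (geq_leqif (dimv_leqif_sup UC)).
rewrite (geq_leqif (dimv_leqif_sup (addvSl _ _))) subv_add subvv.
by apply: contra xU => /subvP; apply; apply: memv_line.
Qed.

Definition common_preim (fs : seq 'End(A)) M : {vspace A} :=
  (\bigcap_(f <- fs) f @^-1: M)%VS.

Lemma common_preimP (fs : seq 'End(A)) M u :
  reflect (forall f, f \in fs -> f u \in M) (u \in common_preim fs M).
Proof.
rewrite /common_preim; elim: fs => [|f fs IH].
  by rewrite big_nil memvf; constructor.
rewrite big_cons memv_cap -memv_preim; apply: (iffP andP) => [[fu /IH h] g|h].
  by rewrite in_cons => /predU1P[-> //|/h].
split; first by apply: h; rewrite mem_head.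
by apply/IH => g gfs; apply: h; rewrite in_cons gfs orbT.
Qed.

(** The preimage in [U] of the part of [(U + M) / M] killed by [C]. *)
Definition transporter C U M : {vspace A} :=
  (U :&: common_preim [seq linfun (mul c) | c <- vbasis C] M)%VS.

Lemma transporterP C U M u :
  reflect (u \in U /\ forall c, c \in C -> mul c u \in M)
          (u \in transporter C U M).
Proof.
rewrite /transporter memv_cap; apply: (iffP andP) => -[uU h]; split => //.
  move=> c cC; rewrite (coord_vbasis cC) linear_sumlz.
  apply: memv_suml => i _; rewrite mulZl; apply: memvZ.
  have := common_preimP _ _ _ h (linfun (mul (vbasis C)`_i)).
  by rewrite lfunE; apply; apply: map_f; rewrite mem_nth ?size_tuple.
by apply/common_preimP => f /mapP[c cC ->]; rewrite lfunE;
  apply/h/vbasis_mem.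
Qed.

Definition left_center : {vspace A} :=
  common_preim [seq linfun (applyr mul y) | y <- vbasis {:A}] 0%VS.

Lemma left_centerP x : reflect (forall y, mul x y = 0) (x \in left_center).
Proof.
apply: (iffP (common_preimP _ _ _)) => h.
  move=> y; rewrite (coord_vbasis (memvf y)) linear_sumr big1 // => i _.
  rewrite mulZr; apply/eqP; rewrite scaler_eq0 -memv0; apply/orP; right.
  have := h (linfun (applyr mul (vbasis {:A})`_i)).
  by rewrite lfunE; apply; apply: map_f; rewrite mem_nth ?size_tuple.
by move=> f /mapP[y _ ->]; rewrite lfunE /= h mem0v.
Qed.

Definition stable C U : Prop := forall c u, c \in C -> u \in U -> mul c u \in U.

(** The conclusion of Engel's theorem: [C] kills a nonzero vector in every
    nonzero section of [A].  Asking this of sections, and not only of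
    subspaces, makes the property usable in the middle of a flag. *)
Definition acts_nilpotently C : Prop :=
  forall M U, stable C M -> stable C U -> ~~ (U <= M)%VS ->
  exists2 u, u \in transporter C U M & u \notin M.

(** Among the iterates of a vector of [U] outside [M], the last one outside [M]
    is sent into [M]. *)
Lemma nilpotent_null_vector x M U :
    nilpotent_map (mul x) -> (forall u, u \in U -> mul x u \in U) ->
    ~~ (U <= M)%VS ->
  exists u, [/\ u \in U, u \notin M & mul x u \in M].
Proof.
move=> [n nil_x] xU /subvPn[u uU uM].
have: iter n (mul x) u \in M by rewrite nil_x mem0v.
elim: n u uU uM {nil_x} => [|n IH] u uU uM; first by rewrite /= (negPf uM).
rewrite iterSr => /IH h.
have [xuM|/h] := boolP (mul x u \in M); first by exists u.
by apply; apply: xU.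
Qed.

Hypothesis leibniz : left_leibniz mul.

(** [T_(xy)] and [T_(yx)] are opposite commutators.  So, modulo the left
    center, the product is antisymmetric. *)
Lemma left_center_sym x y : mul x y + mul y x \in left_center.
Proof.
apply/left_centerP => z; rewrite mulDl; have := leibniz x y z.
by rewrite (leibniz y x z) addrA -[LHS]add0r => /addIr.
Qed.

Lemma left_center_sqr x : mul x x \in left_center.
Proof.
apply/left_centerP => z.
by have := leibniz x x z; rewrite -[LHS]add0r => /addIr.
Qed.

Lemma stable_left_center : stable {:A} left_center.
Proof.
move=> x j _ /left_centerP j0; apply/left_centerP => y.
by have := leibniz x j y; rewrite !j0 linear0 addr0 => <-.
Qed.

(** Since [x] normalizes [C], the vectors killed by [C] in a section are stable
    under [T_x], which has a null vector among them. *)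
Lemma engel_extend C x :
    acts_nilpotently C -> nilpotent_map (mul x) ->
    (forall c, c \in C -> mul x c \in C) ->
  acts_nilpotently (C + <[x]>)%VS.
Proof.
move=> nilC nil_x xC M U sM sU UM.
have CE c : c \in C -> c \in (C + <[x]>)%VS by apply/subvP/addvSl.
have xE : x \in (C + <[x]>)%VS by apply: subvP (addvSr _ _) _ (memv_line x).
have [|||u uU uM] := nilC M U.
- by move=> c u /CE; apply: sM.
- by move=> c u /CE; apply: sU.
- exact: UM.
have CUM : ~~ (transporter C U M <= M)%VS by apply/subvPn; exists u.
have [|v [vU vM xv]] := nilpotent_null_vector nil_x _ CUM.
  move=> w /transporterP[wU Cw]; apply/transporterP; split; first exact: sU.
  move=> c cC; have -> : mul c (mul x w) = mul x (mul c w) - mul (mul x c) w.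
    by rewrite (leibniz x) addrC addKr.
  by rewrite memvB ?(Cw _ (xC _ _)) // sM // Cw.
exists v => //; case/transporterP: vU => vU Cv; apply/transporterP; split=> //.
move=> _ /memv_addP[c cC [_ /vlineP[a ->] ->]].
by rewrite mulDl mulZl; apply: memvD; [apply: Cv | apply: memvZ].
Qed.

(** A subalgebra [H] of [C] already known to act nilpotently is enlarged one
    dimension at a time: it kills some [x] in the section [C / H], so that [H]
    sends [x] into [H].  To keep [H + <x>] closed under products one also needs
    [x * H] and [x * x] to lie in [H]; the product not being antisymmetric,
    this is ensured by starting from the left center of [A] in [C]. *)
Theorem engel C : stable C C -> nil_on mul C -> acts_nilpotently C.
Proof.
move=> CC nilC; pose J := (left_center :&: C)%VS.
(* [J] itself acts by zero, which starts the enlargement. *)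
suff: forall n H, (\dim C - \dim H < n)%N -> (J <= H)%VS -> (H <= C)%VS ->
    stable H H -> acts_nilpotently H -> acts_nilpotently C.
  move=> /(_ _ J (ltnSn _) (subvv J) (capvSr _ _)); apply.
    by move=> x y /memv_capP[/left_centerP-> _] _; apply: mem0v.
  move=> M U _ _ /subvPn[u uU uM]; exists u => //; apply/transporterP.
  by split=> // x /memv_capP[/left_centerP-> _]; apply: mem0v.
elim=> // n IH H dimH JH HC HH nilH.
have [CH|CH] := boolP (C <= H)%VS.
  by have <- : H = C by apply/eqP; rewrite eqEsubv HC.
have [|x /transporterP[xC Hx] xH] := nilH H C HH _ CH.
  by move=> c u /(subvP HC); apply: CC.
have JHE j : j \in left_center -> j \in C -> j \in H.
  by move=> jJ jC; apply: (subvP JH); rewrite memv_cap jJ.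
have xxH : mul x x \in H by apply: JHE; [apply: left_center_sqr | apply: CC].
have xH' c : c \in H -> mul x c \in H.
  move=> cH; have cC := subvP HC c cH.
  rewrite -[mul x c](addrK (mul c x)) memvB ?Hx //.
  by apply: JHE; [apply: left_center_sym | apply: memvD; apply: CC].
apply: (IH (H + <[x]>)%VS).
- exact: leq_trans (ltn_codim_add_line HC CH xH) dimH.
- exact: subv_trans (addvSl _ _).
- by rewrite subv_add HC; apply/subvP => _ /vlineP[a ->]; apply: memvZ.
- move=> _ d' /memv_addP[c cH [_ /vlineP[a ->] ->]].
  move=> /memv_addP[d dH [_ /vlineP[b ->] ->]].
  apply: (subvP (addvSl _ _)).
  rewrite mulDl !mulDr !mulZl !mulZr; apply: memvD; apply: memvD.
  - exact: HH.
  - by apply: memvZ; apply: Hx.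
  - by apply: memvZ; apply: xH'.
  - by do 2?apply: memvZ.
- by apply: engel_extend => //; apply: nilC.
Qed.

End NilpotentAction.

(** * Triangular matrices as stable flags *)

Section Flags.

Variables (F : fieldType) (A : vectType F).

Lemma mem_span_take (b : seq A) k i :
  (k < i)%N -> (k < size b)%N -> b`_k \in <<take i b>>%VS.
Proof.
move=> ki kb; apply: memv_span; rewrite -(nth_take 0 ki).
by apply: mem_nth; rewrite size_take_min leq_min ki.
Qed.

Lemma upper_triangularP n (b : n.-tuple A) (f : A -> A) :
    basis_of {:A} b ->
  upper_triangular (mx_in_basis b f) <->
  forall j : 'I_n, f b`_j \in <<take j.+1 b>>%VS.
Proof.
move=> basis_b; split=> [tri j|tri i j ji].
  rewrite (coord_basis basis_b (memvf (f b`_j))); apply: memv_suml => i _.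
  have [ij|ji] := leqP i j.
    by apply/memvZ/mem_span_take; rewrite ?size_tuple.
  by have := tri i j ji; rewrite mxE => ->; rewrite scale0r mem0v.
rewrite mxE; apply/eqP.
suff: f b`_j \in lker (linfun (coord b i : A -> F^o)) by rewrite memv_ker lfunE.
apply: (subvP _ _ (tri j)); apply/span_subvP => u /(nthP 0)[k].
rewrite size_take_min size_tuple leq_min => /andP[kj kn] <-.
rewrite nth_take // memv_ker lfunE /=.
rewrite (coord_free (Ordinal kn) i (basis_free basis_b)) -val_eqE /=.
by rewrite eqn_leq [(i <= k)%N]leqNgt (leq_trans kj ji) andbF.
Qed.

End Flags.

(** * Triangulation over an algebraically closed field *)

Section ClosedField.

Variables (K : closedFieldType) (A : vectType K).
Implicit Types (M U : {vspace A}).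

(** The iterates of [u] up to the dimension of [A] are too many to be
    independent. *)
Lemma linear_relation (f : A -> A) (u : A) :
  exists2 p : {poly K}, p != 0 & \sum_(i < size p) p`_i *: iter i f u = 0.
Proof.
pose n := \dim {:A}; pose e := vbasis {:A}.
pose X : 'M[K]_(n.+1, n) := \matrix_(i, j) coord e j (iter i f u).
have: kermx X != 0.
  by rewrite kermx_eq0 -row_leq_rank -ltnNge ltnS rank_leq_col.
case/rowV0Pn => c /sub_kermxP cX c0; exists (rVpoly c).
  by apply: contraNneq c0 => c0; rewrite -(rVpolyK c) c0 linear0.
have le_c : (size (rVpoly c) <= n.+1)%N by apply: size_poly.
have -> : \sum_(i < size (rVpoly c)) (rVpoly c)`_i *: iter i f u
        = \sum_(i < n.+1) c 0 i *: iter i f u.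
  rewrite (big_ord_widen _ (fun i => (rVpoly c)`_i *: iter i f u) le_c).
  rewrite big_mkcond.
  apply: eq_bigr => i _; rewrite coef_rVpoly_ord; case: ltnP => // ci.
  by rewrite -coef_rVpoly_ord nth_default ?scale0r.
rewrite (coord_vbasis (memvf (\sum_i _))) big1 // => j _.
have := congr1 (fun v : 'rV_n => v 0 j) cX; rewrite !mxE => E.
rewrite linear_sum -[X in X *: _ = _]/(\sum_i coord e j (c 0 i *: iter i f u)).
rewrite (_ : \sum_i _ = 0) ?scale0r // -[RHS]E; apply: eq_bigr => i _.
by rewrite linearZ mxE.
Qed.

(** A polynomial [p] with [p(f) u] in [M] is split into linear factors; applied
    one after the other to [u], these end up in [M], and the first one that
    enters [M] gives the eigenvector. *)
Lemma eigenvector_mod (f : {linear A -> A}) M U :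
    (forall u, u \in U -> f u \in U) -> ~~ (U <= M)%VS ->
  exists a u, [/\ u \in U, u \notin M & f u - a *: u \in M].
Proof.
move=> fU /subvPn[u uU uM]; have [p p0] := linear_relation f u.
have [n size_p] : exists n, size p = n.+1.
  by exists (size p).-1; rewrite prednK // size_poly_gt0.
rewrite size_p => pu; have {pu} : \sum_(i < n.+1) p`_i *: iter i f u \in M.
  by rewrite pu mem0v.
elim: n p u uU uM size_p {p0} => [|n IH] p u uU uM size_p.
  rewrite big_ord_recl big_ord0 addr0 /= => puM; case/negP: uM.
  have p00 : p`_0 != 0.
    have := lead_coef_eq0 p.
    by rewrite lead_coefE size_p /= -size_poly_eq0 size_p => ->.
  by rewrite -[u](scalerK p00) memvZ.
have /closed_rootP[a /factor_theorem[q pE]] : size p != 1 by rewrite size_p.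
have size_q : size q = n.+1.
  have q0 : q != 0.
    apply: contra_eq_neq size_p => /eqP; rewrite pE => /eqP->.
    by rewrite mul0r size_poly0.
  move: size_p; rewrite pE size_Mmonic ?monicXsubC // size_XsubC.
  by rewrite addn2 => -[].
have [wM _|wM puM] := boolP (f u - a *: u \in M); first by exists a, u.
apply: (IH q (f u - a *: u)) => //; first by rewrite memvB ?memvZ ?fU.
congr (_ \in M): puM.
have iterB i : iter i f (f u - a *: u) = iter i.+1 f u - a *: iter i f u.
  elim: i => // i IHi.
  by rewrite iterS IHi linearB linearZ.
have coef_p i : p`_i = (q * 'X)`_i - q`_i * a by rewrite pE mulrBr coefB coefMC.
under eq_bigr => i _ do rewrite coef_p scalerBl.
rewrite sumrB [X in X - _]big_ord_recl /= coefMX /= scale0r add0r.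
rewrite [X in _ - X]big_ord_recr /= (_ : q`_n.+1 = 0) ?nth_default ?size_q //.
rewrite mul0r scale0r addr0 -sumrB; apply: eq_bigr => i _.
by rewrite coefMX iterB scalerBr scalerA.
Qed.

Variable mul : {bilinear A -> A -> A}.
Hypothesis leibniz : left_leibniz mul.

(** The hypothesis on [mul (mul x y) u] says that left multiplications commute
    on [U] modulo [M]; each eigenspace of one of them is then stable under the
    others, and it suffices to treat the finitely many elements of a basis. *)
Lemma common_eigenvector_mod M U :
    stable mul {:A} M -> stable mul {:A} U -> ~~ (U <= M)%VS ->
    (forall x y u, u \in U -> mul (mul x y) u \in M) ->
  exists v, [/\ v \in U, v \notin M & forall x, mul x v \in (M + <[v]>)%VS].
Proof.
move=> sM sU UM comm.
(* The operators are treated one after the other: each step shrinks [U] to an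
   eigenspace modulo [M] of the next one. *)
suff [v [vU vM eig]] : exists v, [/\ v \in U, v \notin M &
    forall x, x \in (vbasis {:A} : seq A) -> exists a, mul x v - a *: v \in M].
  exists v; split=> // x; rewrite (coord_vbasis (memvf x)) linear_sumlz.
  apply: memv_suml => i _; rewrite mulZl; apply: memvZ.
  have [|a aM] := eig (vbasis {:A})`_i; first by rewrite mem_nth ?size_tuple.
  by rewrite -[mul _ v](subrK (a *: v)) memv_add ?memvZ ?memv_line.
elim: (vbasis {:A} : seq A) U sU UM comm => [|x s IH] U sU UM comm.
  by have /subvPn[v vU vM] := UM; exists v.
have [|a [u [uU uM au]]] := eigenvector_mod (f := mul x) _ UM.
  by move=> u; apply: sU; apply: memvf.
pose U' := (U :&: (linfun (mul x) - a *: \1)%VF @^-1: M)%VS.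
have memU' w : (w \in U') = (w \in U) && (mul x w - a *: w \in M).
  by rewrite memv_cap -memv_preim add_lfunE opp_lfunE
    scale_lfunE id_lfunE lfunE.
have [||| v [vU' vM eig]] := IH U'.
- move=> y w _; rewrite !memU' => /andP[wU wM]; rewrite sU ?memvf //=.
  rewrite leibniz -addrA -mulZr -mulBr.
  by apply: memvD; [apply: comm | apply: sM; rewrite ?memvf].
- by apply/subvPn; exists u; rewrite // memU' uU.
- by move=> y z w; rewrite memU' => /andP[wU _]; apply: comm.
move: vU'; rewrite memU' => /andP[vU av]; exists v; split=> // y.
by rewrite in_cons => /predU1P[->|/eig//]; exists a.
Qed.

Hypothesis nil_square : acts_nilpotently mul (square mul).

(** On the vectors of [U] that the square sends into [M], left multiplications
    commute modulo [M]. *)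
Lemma left_eigenvector_mod M U :
    stable mul {:A} M -> stable mul {:A} U -> ~~ (U <= M)%VS ->
  exists v, [/\ v \in U, v \notin M & forall x, mul x v \in (M + <[v]>)%VS].
Proof.
move=> sM sU UM; pose U' := transporter mul (square mul) U M.
have [|||v [vU' vM eig]] := @common_eigenvector_mod M U' sM.
- move=> x u _ /transporterP[uU squ]; apply/transporterP.
  split=> [|c cC]; first by rewrite sU ?memvf.
  have -> : mul c (mul x u) = mul x (mul c u) - mul (mul x c) u.
    by rewrite (leibniz x) addrC addKr.
  by apply: memvB; [apply/sM/squ; rewrite ?memvf | apply/squ/mul_square].
- have [|||u uU' uM] := nil_square (M := M) (U := U) => //.
  + by move=> x u _; apply: sM; apply: memvf.
  + by move=> x u _; apply: sU; apply: memvf.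
  by apply/subvPn; exists u.
- by move=> x y u /transporterP[_]; apply; apply: mul_square.
by exists v; split=> //; case/transporterP: vU'.
Qed.

(** The dichotomy on the left center [Z] reduces right multiplications to left
    ones: modulo a subspace containing [Z] they are opposite, and on [Z] they
    are zero. *)
Lemma flag_step M :
    stable mul {:A} M -> ~~ ({:A} <= M)%VS ->
  exists2 v, v \notin M &
    forall x, mul x v \in (M + <[v]>)%VS /\ mul v x \in (M + <[v]>)%VS.
Proof.
move=> sM AM; have [JM|JM] := boolP (left_center mul <= M)%VS.
  have [|v [_ vM eig]] := left_eigenvector_mod sM _ AM.
    by move=> *; apply: memvf.
  exists v => // x; split=> //; rewrite -[mul v x](addKr (mul x v)).
  rewrite memvD ?memvN //; apply: (subvP (addvSl _ _)); apply: (subvP JM).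
  exact: left_center_sym.
have [v [vJ vM eig]] := left_eigenvector_mod sM (stable_left_center leibniz) JM.
by exists v => // x; split=> //; move/left_centerP: vJ => ->; apply: mem0v.
Qed.

Theorem triangular_basis_of_nil_square : has_triangular_basis mul.
Proof.
pose tri (b : seq A) := forall k x, (k < size b)%N ->
  mul x b`_k \in <<take k.+1 b>>%VS /\ mul b`_k x \in <<take k.+1 b>>%VS.
have: forall n, (n <= \dim {:A})%N -> exists b, [/\ size b = n, free b & tri b].
  elim=> [|n IH] n_lt; first by exists [::]; rewrite nil_free.
  have [b [size_b free_b tri_b]] := IH (ltnW n_lt).
  have [||v vM eig] := @flag_step <<b>>%VS.
  - move=> x u _ ub; rewrite (coord_span (X := in_tuple b) ub) linear_sumr.
    apply: memv_suml => i _; rewrite mulZr; apply: memvZ.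
    have [+ _] := tri_b i x (ltn_ord i).
    apply/subvP/sub_span => w; exact: mem_take.
  - apply: contraL n_lt => /dimvS; rewrite -leqNgt => /leq_trans; apply.
    by rewrite -size_b dim_span.
  exists (rcons b v); split; first by rewrite size_rcons size_b.
    by rewrite (perm_free (permEl (perm_rcons v b))) free_cons vM.
  move=> k x; rewrite size_rcons ltnS leq_eqVlt nth_rcons => /predU1P[->|kb].
    rewrite ltnn eqxx take_oversize ?size_rcons // -cats1 span_cat span_seq1.
    exact: eig.
  by rewrite kb -cats1 takel_cat //; apply: tri_b.
case/(_ _ (leqnn _)) => b [/eqP size_b free_b tri_b].
have basis_b : basis_of {:A} (Tuple size_b).
  by rewrite basisEfree free_b subvf /= (eqP size_b) leqnn.
exists (Tuple size_b); split=> // x.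
by split; apply/(upper_triangularP _ basis_b) => j;
  have [] := tri_b j x; rewrite ?(eqP size_b).
Qed.

End ClosedField.

(** * Triangular algebras have a nil square *)

Section Triangular.

Variables (F : fieldType) (A : vectType F) (mul : {bilinear A -> A -> A}).
Hypothesis leibniz : left_leibniz mul.

(** On the line [W_(j+1) / W_j] of the flag each [T_x] is a scalar, so the
    commutator [T_(xy)] vanishes there; the elements of the square shift the
    flag by one step. *)
Theorem nil_square_of_triangular_basis :
  has_triangular_basis mul -> nil_on mul (square mul).
Proof.
move=> [b [basis_b tri_b]]; pose W k := <<take k b>>%VS.
have WS i k : (i <= k)%N -> (W i <= W k)%VS.
  move=> ik; rewrite /W -(take_takel _ ik).
  by apply: sub_span => w; apply: mem_take.
have W_sub (V : {vspace A}) k :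
    (forall i : 'I_(\dim {:A}), (i < k)%N -> b`_i \in V) -> (W k <= V)%VS.
  move=> bV; apply/span_subvP => u /(nthP 0)[i].
  rewrite size_take_min size_tuple leq_min => /andP[ik i_lt] <-.
  by rewrite nth_take //; apply: (bV (Ordinal i_lt)).
have triT x (j : 'I_(\dim {:A})) :
    exists a w, w \in W j /\ mul x b`_j = w + a *: b`_j.
  have /(upper_triangularP _ basis_b)/(_ j) := (tri_b x).1.
  rewrite (take_nth 0) ?size_tuple // -cats1 span_cat span_seq1.
  by case/memv_addP => w wW [_ /vlineP[a ->] ->]; exists a, w.
have WT x k w : w \in W k -> mul x w \in W k.
  move=> wW; rewrite -lfunE memv_preim.
  apply: (subvP _ _ wW); apply: W_sub => i ik; rewrite -memv_preim lfunE /=.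
  have [a [v [vW ->]]] := triT x i.
  apply: memvD; first exact: (subvP (WS _ _ (ltnW ik))).
  by apply/memvZ/mem_span_take; rewrite ?size_tuple.
have commT x y (j : 'I_(\dim {:A})) : mul (mul x y) b`_j \in W j.
  have -> : mul (mul x y) b`_j = mul x (mul y b`_j) - mul y (mul x b`_j).
    by rewrite (leibniz x) addrK.
  have [[a [v [vW xb]]] [c [w [wW yb]]]] := (triT x j, triT y j).
  rewrite xb yb !mulDr !mulZr xb yb !scalerDr !scalerA [c * a]mulrC.
  by rewrite !addrA opprD addrACA subrr addr0 memvB ?memvD ?memvZ ?WT.
move=> z /mem_square[m [c [x [y ->]]]]; set z' := \sum_i _.
have nilT (j : 'I_(\dim {:A})) : mul z' b`_j \in W j.
  rewrite linear_sumlz; apply: memv_suml => i _.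
  by rewrite mulZl; apply/memvZ/commT.
exists (\dim {:A}) => v; have: v \in W (\dim {:A}).
  by rewrite /W take_oversize ?size_tuple // (span_basis basis_b) memvf.
elim: (\dim _) v => [|k IH] v vW /=.
  by apply/eqP; move: vW; rewrite /W take0 span_nil memv0.
rewrite -iterS iterSr IH // -[mul z' v]lfunE memv_preim.
apply: (subvP _ _ vW); apply: W_sub => i ik.
by rewrite -memv_preim lfunE; apply: (subvP (WS _ _ _) _ (nilT i)).
Qed.

End Triangular.

(** * Extension of scalars *)

Section Extension.

Variables (F K : fieldType) (iota : {rmorphism F -> K}) (A : vectType F).
Variable mul : {bilinear A -> A -> A}.
Implicit Types (C M N : {vspace A}).

Local Notation tensor := 'rV[K]_(\dim {:A}).
Local Notation "1(x)" := (@tensor1 F K iota A).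

Let tmul : {bilinear tensor -> tensor -> tensor} := tensor_mul iota mul.

Lemma tensor1_eq0 x : 1(x) x = 0 -> x = 0.
Proof.
move=> x0; rewrite (coord_vbasis (memvf x)) big1 // => i _.
have /eqP := congr1 (fun u : tensor => u 0 i) x0.
by rewrite !mxE fmorph_eq0 => /eqP->; rewrite scale0r.
Qed.

(** [K (x) M] as a subspace of [K (x) A]. *)
Definition tensorv M : {vspace tensor} := <<[seq 1(x) a | a <- vbasis M]>>%VS.

Lemma mem_tensorv M a : a \in M -> 1(x) a \in tensorv M.
Proof.
move=> aM; rewrite (coord_vbasis aM) tensor1_sum; apply: memv_suml => i _.
rewrite tensor1Z; apply/memvZ/memv_span/map_f.
by rewrite mem_nth ?size_tuple.
Qed.

Lemma tensorv_sub M (V : {vspace tensor}) :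
  (forall a, a \in M -> 1(x) a \in V) -> (tensorv M <= V)%VS.
Proof. by move=> MV; apply/span_subvP => _ /mapP[a /vbasis_mem/MV aV ->]. Qed.

Lemma tensorv_full : tensorv {:A} = fullv.
Proof.
apply/eqP; rewrite eqEsubv subvf; apply/subvP => u _.
rewrite (tensor_basisE iota u).
by apply: memv_suml => i _; apply/memvZ/mem_tensorv/memvf.
Qed.

Lemma tensorv_mul C M N :
    (forall c a, c \in C -> a \in M -> mul c a \in N) ->
  forall z u, z \in tensorv C -> u \in tensorv M -> tmul z u \in tensorv N.
Proof.
move=> CMN z u zC uM.
suff /subvP/(_ z zC): (tensorv C <= linfun (applyr tmul u) @^-1: tensorv N)%VS.
  by rewrite -memv_preim lfunE.
apply: tensorv_sub => c cC; rewrite -memv_preim lfunE /=.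
suff /subvP/(_ u uM): (tensorv M <= linfun (tmul (1(x) c)) @^-1: tensorv N)%VS.
  by rewrite -memv_preim lfunE.
apply: tensorv_sub => a aM; rewrite -memv_preim lfunE /=.
by rewrite tensor1M; apply/mem_tensorv/CMN.
Qed.

Lemma tensorv_square : tensorv (square mul) = square tmul.
Proof.
apply/eqP; rewrite eqEsubv; apply/andP; split.
  apply: tensorv_sub => z /mem_square[n [c [x [y ->]]]].
  rewrite tensor1_sum; apply: memv_suml => i _.
  by rewrite tensor1Z -tensor1M; apply/memvZ/(mul_square tmul).
apply/span_subvP => _ /allpairsP[[u v] [_ _ ->]] /=.
apply: memv_suml => i _; apply: memv_suml => j _.
by apply/memvZ/mem_tensorv/mul_square.
Qed.

(** Nilpotency of the action of [C] gives a flag of [A] that [C] shifts by one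
    step, hence so does its extension [K (x) C] with the extended flag.  If
    [K (x) C] killed no nonzero vector of the section [U / M], then climbing
    the flag would show that [U] meets each of its terms inside [M]. *)
Lemma tensor_acts_nilpotently C :
  acts_nilpotently mul C -> acts_nilpotently tmul (tensorv C).
Proof.
move=> nilC M U sM sU UM.
have [XM|/subvPn[u uX uM]] := boolP (transporter tmul (tensorv C) U M <= M)%VS;
  last by exists u.
case/negP: UM.
(* [N] climbs the flag, from the zero subspace up to the whole of [A]. *)
suff: forall n N, (\dim {:A} - \dim N < n)%N -> stable mul C N ->
    (U :&: tensorv N <= M)%VS -> (U <= M)%VS.
  move=> /(_ _ 0%VS (ltnSn _)); apply.
    by move=> c u _; rewrite !memv0 => /eqP->; rewrite linear0.
  apply: subv_trans (capvSr _ _) _; apply: tensorv_sub => a.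
  rewrite memv0 => /eqP->; suff -> : 1(x) 0 = 0 by apply: mem0v.
  by apply/rowP => i; rewrite !mxE linear0 rmorph0.
elim=> // n IH N dimN CN UN.
have [fullN|AN] := boolP ({:A} <= N)%VS.
  suff NE : N = fullv by move: UN; rewrite NE tensorv_full capvf.
  by apply/eqP; rewrite eqEsubv subvf.
have [|x /transporterP[_ Cx] xN] := nilC N fullv CN _ AN.
  by move=> *; apply: memvf.
have CN' c a : c \in C -> a \in (N + <[x]>)%VS -> mul c a \in N.
  move=> cC /memv_addP[d dN [_ /vlineP[k ->] ->]]; rewrite mulDr mulZr.
  by apply: memvD; [apply: CN | apply/memvZ/Cx].
apply: (IH (N + <[x]>)%VS).
- exact: leq_trans (ltn_codim_add_line (subvf N) AN xN) dimN.
- by move=> c a cC aN; apply: (subvP (addvSl _ _)); apply: CN'.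
apply/subvP => u /memv_capP[uU uN]; apply: (subvP XM); apply/transporterP.
split=> // z zC; apply: (subvP UN); apply/memv_capP; split; first exact: sU.
exact: tensorv_mul CN' _ _ zC uN.
Qed.

Lemma nilpotent_map_tensor1 x :
  nilpotent_map (tmul (1(x) x)) -> nilpotent_map (mul x).
Proof.
move=> [n nil_x]; exists n => v; apply: tensor1_eq0; rewrite -(nil_x (1(x) v)).
by elim: n {nil_x} => //= n <-; rewrite tensor1M.
Qed.

End Extension.

Theorem theorem3 (F : fieldType) (A : vectType F)
    (mul : {bilinear A -> A -> A}) (mul_leibniz : left_leibniz mul)
    (K : closedFieldType) (iota : {rmorphism F -> K})
    (K_closure : algebraic_closure iota) :
  triangulable iota mul <-> nil_on mul (square mul).
Proof.
have t_leibniz := tensor_leibniz iota mul_leibniz.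
split=> [/(nil_square_of_triangular_basis t_leibniz) nilT x xA2|nilA2].
  apply/(@nilpotent_map_tensor1 _ _ iota)/nilT.
  by rewrite -tensorv_square; apply: mem_tensorv.
apply: (triangular_basis_of_nil_square t_leibniz).
rewrite -tensorv_square; apply/tensor_acts_nilpotently/engel => //.
by move=> x y _ _; apply: mul_square.
Qed.
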